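(* Let $(F,v)$ be a valued field, $A$ an $F$-algebra, $\sigma$ an $F$-linear involution on $A$, and $\varphi\colon A\to\Gamma\cup\{\infty\}$ a surmultiplicative $v$-value function. The following conditions are equivalent: (a) $\varphi(\sigma(x)x)=2\varphi(x)$ for all $x\in A$; (b) $\varphi$ is invariant under $\sigma$, and the induced involution $\tilde\sigma$ on $\mathrm{gr}_\varphi(A)$ is anisotropic. They imply that if $x,y\in A$ satisfy $\sigma(x)y=0$ or $x\sigma(y)=0$, then $\varphi(x+y)=\min(\varphi(x),\varphi(y))$. Moreover, when these equivalent conditions hold, $\sigma$ is anisotropic and the $\mathrm{gr}(F)$-algebra $\mathrm{gr}_\varphi(A)$ contains no nonzero homogeneous nil left or right ideal.
   Context: Fix a divisible totally ordered abelian group $\Gamma$; valuations and value functions take values in $\Gamma\cup\{\infty\}$. For a valued field $(F,v)$, a $v$-value function on an $F$-vector space $V$ is a map $\alpha\colon V\to\Gamma\cup\{\infty\}$ with (i) $\alpha(x)=\infty$ iff $x=0$; (ii) $\alpha(x+y)\ge\min(\alpha(x),\alpha(y))$; (iii) $\alpha(xc)=\alpha(x)+v(c)$ for $x,y\in V$, $c\in F$. A $v$-value function $\varphi$ on an $F$-algebra $A$ is surmultiplicative if $\varphi(1)=0$ and $\varphi(xy)\ge\varphi(x)+\varphi(y)$ for all $x,y\in A$. For a surmultiplicative $\varphi$ put $A^{\ge\gamma}=\{x\mid\varphi(x)\ge\gamma\}$, $A^{>\gamma}=\{x\mid\varphi(x)>\gamma\}$, $A_\gamma=A^{\ge\gamma}/A^{>\gamma}$,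 $\mathrm{gr}_\varphi(A)=\bigoplus_{\gamma\in\Gamma}A_\gamma$; similarly $\mathrm{gr}(F)$ is defined from $v$. For $x\ne0$, $\tilde x=x+A^{>\varphi(x)}\in A_{\varphi(x)}$, and $\tilde0=0$. $\mathrm{gr}_\varphi(A)$ is a graded $\mathrm{gr}(F)$-algebra with $\tilde a\tilde b=ab+A^{>\varphi(a)+\varphi(b)}$. An $F$-linear involution on $A$ is an $F$-linear map $\sigma\colon A\to A$ with $\sigma(xy)=\sigma(y)\sigma(x)$ and $\sigma^2=\mathrm{id}$. $\varphi$ is invariant under $\sigma$ if $\varphi(\sigma(x))=\varphi(x)$ for all $x$; then $\sigma$ induces an involution $\tilde\sigma$ on $\mathrm{gr}_\varphi(A)$ by $\tilde\sigma(\tilde x)=\widetilde{\sigma(x)}$. The involution $\sigma$ is anisotropic if there is no nonzero $x\in A$ with $\sigma(x)x=0$; $\tilde\sigma$ is anisotropic if there is no nonzero homogeneous $\xi\in\mathrm{gr}_\varphi(A)$ with $\tilde\sigma(\xi)\xi=0$. An ideal is homogeneous if it is generated by homogeneous elements, and nil if all of its elements are nilpotent. *)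

(* Defs.v *)
From HB Require Import structures.
From mathcomp Require Import all_boot all_order all_algebra.
From mathcomp Require Import finmap boolp classical_sets functions cardinality fsbigop.

Set Implicit Arguments.
Unset Strict Implicit.
Unset Printing Implicit Defensive.

Import Order.TTheory GRing.Theory.

Local Open Scope classical_set_scope.
Local Open Scope quotient_scope.
Local Open Scope ring_scope.

HB.mixin Record isOrderedGroup G of Num.POrderedZmodule G := {
  og_le_total : total (<=%R : rel G);
  og_lerD2r : forall z x y : G, x <= y -> x + z <= y + z
}.

#[short(type="orderedGroupType")]
HB.structure Definition OrderedGroup :=
  {G of Num.POrderedZmodule G & isOrderedGroup G}.

Definition divisible_group (G : zmodType) : Prop :=
  forall (n : nat) (g : G), (0 < n)%N -> exists h : G, h *+ n = g.

Section OrderedGroupTheory.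
Variable G : orderedGroupType.
Implicit Types x y z t : G.

Lemma og_leNgt x y : (x <= y) = ~~ (y < x).
Proof. by rewrite comparable_leNgt // /Order.comparable og_le_total. Qed.

Lemma og_ltNge x y : (x < y) = ~~ (y <= x).
Proof. by rewrite comparable_ltNge // /Order.comparable og_le_total. Qed.

Lemma og_lerD x y z t : x <= y -> z <= t -> x + z <= y + t.
Proof.
move=> xy zt. apply: (le_trans (og_lerD2r z _ _ xy)).
by rewrite ![y + _]addrC og_lerD2r.
Qed.

Lemma og_lerD2rE z x y : (x + z <= y + z) = (x <= y).
Proof.
apply/idP/idP => [h|]; last exact: og_lerD2r.
by rewrite -[x](addrK z) -[y](addrK z) og_lerD2r.
Qed.

Lemma og_ltrD2rE z x y : (x + z < y + z) = (x < y).
Proof. by rewrite !og_ltNge og_lerD2rE. Qed.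

Lemma og_ltr_leD x y z t : x < y -> z <= t -> x + z < y + t.
Proof.
move=> xy zt; apply: (@lt_le_trans _ _ (y + z)); first by rewrite og_ltrD2rE.
exact: og_lerD.
Qed.

Lemma og_ler_ltD x y z t : x <= y -> z < t -> x + z < y + t.
Proof. by move=> xy zt; rewrite addrC [y + t]addrC og_ltr_leD. Qed.

Lemma og_double_eq0 x : x + x = 0 -> x = 0.
Proof.
move=> x0; apply: le_anti; apply/andP; split; rewrite og_leNgt; apply/negP => h.
  by have := og_ltr_leD h (ltW h); rewrite addr0 x0 ltxx.
by have := og_ltr_leD h (ltW h); rewrite addr0 x0 ltxx.
Qed.

End OrderedGroupTheory.

Inductive ext (G : Type) : Type := Fin of G | Inf.
Arguments Inf {G}.

Definition option_of_ext G (x : ext G) := if x is Fin g then Some g else None.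
Definition ext_of_option G (x : option G) := if x is Some g then Fin g else Inf.
Lemma option_of_extK G : cancel (@option_of_ext G) (@ext_of_option G).
Proof. by case. Qed.

HB.instance Definition _ (G : eqType) :=
  Equality.copy (ext G) (can_type (@option_of_extK G)).
HB.instance Definition _ (G : choiceType) :=
  Choice.copy (ext G) (can_type (@option_of_extK G)).

Section Ext.
Variable G : orderedGroupType.
Implicit Types x y z : ext G.

Definition ext_le x y : bool :=
  match x, y with
  | _, Inf => true
  | Inf, Fin _ => false
  | Fin a, Fin b => a <= b
  end.

Lemma ext_le_refl : reflexive ext_le.
Proof. by case=> /=. Qed.
Lemma ext_le_anti : antisymmetric ext_le.
Proof. by case=> [a|] [b|] //= /le_anti ->. Qed.
Lemma ext_le_trans : transitive ext_le.
Proof. by case=> [a|] [b|] [c|] //=; apply: le_trans. Qed.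
Lemma ext_le_total : total ext_le.
Proof. by case=> [a|] [b|] //=; apply: og_le_total. Qed.

HB.instance Definition _ :=
  Order.Le_isPOrder.Build ring_display (ext G)
    ext_le_refl ext_le_anti ext_le_trans.
HB.instance Definition _ :=
  Order.POrder_isTotal.Build ring_display (ext G) ext_le_total.

Definition ext_add x y : ext G :=
  if x is Fin a then if y is Fin b then Fin (a + b) else Inf else Inf.

Lemma ext_addA : associative ext_add.
Proof. by case=> [a|] [b|] [c|] //=; rewrite addrA. Qed.
Lemma ext_addC : commutative ext_add.
Proof. by case=> [a|] [b|] //=; rewrite addrC. Qed.
Lemma ext_add0 : left_id (Fin 0) ext_add.
Proof. by case=> [a|] //=; rewrite add0r. Qed.

HB.instance Definition _ :=
  GRing.isNmodule.Build (ext G) ext_addA ext_addC ext_add0.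

Lemma ext_zeroE : 0 = Fin 0 :> ext G. Proof. by []. Qed.
Lemma ext_leE (a b : G) : (Fin a <= Fin b) = (a <= b). Proof. by []. Qed.
Lemma ext_ltE (a b : G) : (Fin a < Fin b) = (a < b).
Proof. by rewrite ltNge og_ltNge. Qed.
Lemma ext_lex1 x : x <= Inf. Proof. by case: x. Qed.
Lemma ext_ltx1 (a : G) : Fin a < Inf. Proof. by rewrite ltNge. Qed.
Lemma ext_addE (a b : G) : Fin a + Fin b = Fin (a + b). Proof. by []. Qed.
Lemma ext_addx1 x : x + Inf = Inf. Proof. by case: x. Qed.
Lemma ext_add1x x : Inf + x = Inf. Proof. by case: x. Qed.

Lemma ext_leD x y z t : x <= y -> z <= t -> x + z <= y + t.
Proof.
case: x y z t => [a|] [b|] [c|] [d|] //; rewrite ?ext_addx1 ?ext_lex1 //.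
by rewrite !ext_addE !ext_leE; apply: og_lerD.
Qed.

Lemma ext_lt_le_add (a b : G) x y :
  Fin a < x -> Fin b <= y -> Fin (a + b) < x + y.
Proof.
case: x y => [c|] [d|] //; rewrite ?ext_addx1 ?ext_add1x ?ext_ltx1 //.
by rewrite !ext_addE !ext_ltE !ext_leE; apply: og_ltr_leD.
Qed.

Lemma ext_le_lt_add (a b : G) x y :
  Fin a <= x -> Fin b < y -> Fin (a + b) < x + y.
Proof. by move=> ax byy; rewrite addrC [x + y]addrC ext_lt_le_add. Qed.

End Ext.

Record valuation (G : orderedGroupType) (F : fieldType) := Valuation {
  valuation_fun :> F -> ext G;
  valuation_inf : forall x, valuation_fun x = Inf <-> x = 0;
  valuation_add : forall x y,
    Num.min (valuation_fun x) (valuation_fun y) <= valuation_fun (x + y);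
  valuation_mul : forall x y,
    valuation_fun (x * y) = valuation_fun x + valuation_fun y
}.

Record value_function (G : orderedGroupType) (F : fieldType)
    (v : valuation G F) (V : lmodType F) := ValueFunction {
  vfun :> V -> ext G;
  vfun_inf : forall x, vfun x = Inf <-> x = 0;
  vfun_add : forall x y, Num.min (vfun x) (vfun y) <= vfun (x + y);
  vfun_scale : forall (c : F) x, vfun (c *: x) = vfun x + v c
}.

Record surmultiplicative (G : orderedGroupType) (F : fieldType)
    (v : valuation G F) (A : algType F) := Surmultiplicative {
  surm_vfun :> value_function v A;
  surm1 : surm_vfun 1 = 0;
  surmM : forall x y : A, surm_vfun x + surm_vfun y <= surm_vfun (x * y)
}.

Record involution (R : comNzRingType) (A : algType R) := Involution {
  invol :> A -> A;
  invol_linear : forall (c : R) x y, invol (c *: x + y) = c *: invol x + invol y;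
  involM : forall x y, invol (x * y) = invol y * invol x;
  involK : involutive invol
}.

Definition anisotropic (R : comNzRingType) (A : algType R)
    (sigma : involution A) : Prop :=
  ~ exists x : A, x <> 0 /\ sigma x * x = 0.

Section ValueFunctionTheory.
Variables (G : orderedGroupType) (F : fieldType) (v : valuation G F).

Lemma valuation1 : v 1 = 0.
Proof.
case E: (v 1) => [a|]; last first.
  by move/(valuation_inf v): E => /eqP; rewrite oner_eq0.
have := valuation_mul v 1 1; rewrite mulr1 E ext_addE => -[] /esym/eqP.
by rewrite -subr_eq0 addrK => /eqP ->.
Qed.

Lemma valuationN1 : v (-1) = 0.
Proof.
have := valuation_mul v (-1) (-1); rewrite mulrNN mulr1 valuation1.
case: (v (-1)) => [a|] //; rewrite ext_addE => -[] /esym /og_double_eq0 ->.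
by [].
Qed.

Variables (V : lmodType F) (alpha : value_function v V).

Lemma vfun0 : alpha 0 = Inf.
Proof. exact/vfun_inf. Qed.

Lemma vfunN x : alpha (- x) = alpha x.
Proof. by rewrite -scaleN1r vfun_scale valuationN1 addr0. Qed.

Lemma vfun_geB g x y : g <= alpha x -> g <= alpha y -> g <= alpha (x - y).
Proof.
move=> gx gy; apply: (le_trans _ (vfun_add alpha x (- y))).
by rewrite vfunN le_min gx.
Qed.

Lemma vfun_gtB g x y : g < alpha x -> g < alpha y -> g < alpha (x - y).
Proof.
move=> gx gy; apply: (lt_le_trans _ (vfun_add alpha x (- y))).
by rewrite vfunN lt_min gx.
Qed.

Lemma vfun_geD g x y : g <= alpha x -> g <= alpha y -> g <= alpha (x + y).
Proof.
by move=> gx gy; apply: (le_trans _ (vfun_add alpha x y)); rewrite le_min gx.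
Qed.

End ValueFunctionTheory.

Record direct_sum (I : choiceType) (M : I -> zmodType) := DirectSum {
  ds_fun :> forall i, M i;
  ds_finite : finite_set [set i | ds_fun i != 0]
}.

Section DirectSum.
Variables (I : choiceType) (M : I -> zmodType).
Implicit Types f g h : direct_sum M.

HB.instance Definition _ := gen_eqMixin (direct_sum M).
HB.instance Definition _ := gen_choiceMixin (direct_sum M).

Lemma ds_ext f g : (forall i, f i = g i) -> f = g.
Proof.
case: f g => [f ff] [g gf] /= fg.
have {}fg : f = g by apply: functional_extensionality_dep.
by subst g; congr DirectSum; apply: Prop_irrelevance.
Qed.

Lemma ds_zero_finite : finite_set [set i | (0 : M i) != 0].
Proof. by apply: (sub_finite_set _ (@finite_set0 I)) => i /=; rewrite eqxx. Qed.
Definition ds_zero := DirectSum ds_zero_finite.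

Lemma ds_opp_finite f : finite_set [set i | - f i != 0].
Proof. by apply: (sub_finite_set _ (ds_finite f)) => i /=; rewrite oppr_eq0. Qed.
Definition ds_opp f := DirectSum (ds_opp_finite f).

Lemma ds_add_finite f g : finite_set [set i | f i + g i != 0].
Proof.
have : finite_set ([set i | f i != 0] `|` [set i | g i != 0]).
  by rewrite finite_setU; split; apply: ds_finite.
apply: sub_finite_set => i /=; have [->|] := eqVneq (f i) 0; last by left.
by rewrite add0r; right.
Qed.
Definition ds_add f g := DirectSum (ds_add_finite f g).

Lemma ds_addA : associative ds_add.
Proof. by move=> f g h; apply: ds_ext => i /=; rewrite addrA. Qed.
Lemma ds_addC : commutative ds_add.
Proof. by move=> f g; apply: ds_ext => i /=; rewrite addrC. Qed.
Lemma ds_add0 : left_id ds_zero ds_add.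
Proof. by move=> f; apply: ds_ext => i /=; rewrite add0r. Qed.
Lemma ds_addN : left_inverse ds_zero ds_opp ds_add.
Proof. by move=> f; apply: ds_ext => i /=; rewrite addNr. Qed.

HB.instance Definition _ :=
  GRing.isZmodule.Build (direct_sum M) ds_addA ds_addC ds_add0 ds_addN.

Lemma ds0E i : (0 : direct_sum M) i = 0. Proof. by []. Qed.
Lemma dsDE f g i : (f + g) i = f i + g i. Proof. by []. Qed.
Lemma dsNE f i : (- f) i = - f i. Proof. by []. Qed.

End DirectSum.

Section GradedComponents.
Variables (G : orderedGroupType) (F : fieldType) (v : valuation G F).
Variables (V : lmodType F) (alpha : value_function v V).

Section Component.
Variable gam : G.

Definition in_ge : {pred V} := [pred x : V | Fin gam <= alpha x].

Lemma in_ge_zmod_closed : zmod_closed in_ge.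
Proof.
by split=> [|x y]; rewrite !inE ?vfun0 ?ext_lex1 //; apply: vfun_geB.
Qed.
HB.instance Definition _ := GRing.isZmodClosed.Build V in_ge in_ge_zmod_closed.

Record ge_sub : Type := GeSub { ge_val : V; ge_valP : ge_val \in in_ge }.
HB.instance Definition _ := [isSub for ge_val].
HB.instance Definition _ := [Choice of ge_sub by <:].
HB.instance Definition _ := [SubChoice_isSubZmodule of ge_sub by <:].

Definition in_gt : {pred ge_sub} :=
  [pred x : ge_sub | Fin gam < alpha (ge_val x)].

Lemma in_gt_zmod_closed : zmod_closed in_gt.
Proof.
split=> [|x y]; rewrite !inE /= ?vfun0 ?ext_ltx1 //; exact: vfun_gtB.
Qed.
HB.instance Definition _ :=
  GRing.isZmodClosed.Build ge_sub in_gt in_gt_zmod_closed.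

Definition gr_comp : zmodType := {ideal_quot in_gt}.

(* [cls x] is the class [x + V^{> gam}], with junk value 0 when
   [alpha x < gam]. *)
Definition cls (x : V) : gr_comp :=
  if insub x is Some u then \pi_{ideal_quot in_gt} (u : ge_sub) else 0.

Definition rep (e : gr_comp) : V := ge_val (repr (e : {ideal_quot in_gt})).

Lemma rep_ge e : Fin gam <= alpha (rep e).
Proof. exact: (ge_valP (repr e)). Qed.

Lemma cls_pi x (gx : x \in in_ge) : cls x = \pi_{ideal_quot in_gt} (GeSub gx).
Proof. by rewrite /cls insubT. Qed.

Lemma repK e : cls (rep e) = e.
Proof.
rewrite (cls_pi (ge_valP (repr e))) -[RHS]reprK.
by congr (\pi_ _); exact: val_inj.
Qed.

Lemma clsD x y : Fin gam <= alpha x -> Fin gam <= alpha y ->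
  cls (x + y) = cls x + cls y.
Proof.
move=> gx gy; rewrite (cls_pi gx) (cls_pi gy) (cls_pi (vfun_geD gx gy)).
rewrite -[RHS]Quotient.pi_add; congr (\pi_ _); exact: val_inj.
Qed.

Lemma cls_eq x y : Fin gam <= alpha x -> Fin gam <= alpha y ->
  (cls x == cls y) = (Fin gam < alpha (x - y)).
Proof.
move=> gx gy; rewrite (cls_pi gx) (cls_pi gy) -Quotient.idealrBE inE /=.
by [].
Qed.

Lemma cls0 : cls 0 = 0.
Proof.
have h : Fin gam <= alpha 0 by rewrite vfun0 ext_lex1.
by apply: (addIr (cls 0)); rewrite -clsD // !add0r.
Qed.

Lemma cls_eq0 x : Fin gam <= alpha x -> (cls x == 0) = (Fin gam < alpha x).
Proof. by move=> gx; rewrite -cls0 cls_eq ?vfun0 ?ext_lex1 // subr0. Qed.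

Lemma cls_congr x y : Fin gam <= alpha x -> Fin gam < alpha (x - y) ->
  cls x = cls y.
Proof.
move=> gx gxy; apply/eqP; rewrite cls_eq //.
by rewrite -[y](subKr x) vfun_geB // ltW.
Qed.

End Component.

Definition gr := direct_sum gr_comp.

HB.instance Definition _ := GRing.Zmodule.on gr.

(* [tilde x] is the class of [x] in degree [alpha x], and [tilde 0 = 0]. *)
Lemma tilde_finite x :
  finite_set [set gam | (if alpha x == Fin gam then cls gam x else 0) != 0].
Proof.
case E: (alpha x) => [a|].
  apply: (sub_finite_set _ (finite_set1 a)) => gam /=.
  by case: ifP; [move=> /eqP[->] | rewrite eqxx].
apply: (sub_finite_set _ (@finite_set0 G)) => gam /=.
by rewrite eqxx.
Qed.
Definition tilde (x : V) : gr := DirectSum (tilde_finite x).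

Definition homogeneous (xi : gr) : Prop :=
  exists gam, forall del, del != gam -> xi del = 0.

Lemma tilde_homogeneous x : homogeneous (tilde x).
Proof.
case E: (alpha x) => [a|]; [exists a|exists 0] => del /=; rewrite E //.
by move=> dela; case: ifP => // /eqP[ad]; rewrite ad eqxx in dela.
Qed.

Lemma tilde0 : tilde 0 = 0.
Proof. by apply: ds_ext => gam /=; rewrite vfun0. Qed.

Lemma homogeneousE xi : homogeneous xi <-> exists x, xi = tilde x.
Proof.
split=> [[gam xi0]|[x ->]]; last exact: tilde_homogeneous.
have [x0|xN0] := eqVneq (xi gam) 0.
  exists 0; rewrite tilde0; apply: ds_ext => del.
  by have [->|/xi0] := eqVneq del gam.
have agam : alpha (rep (xi gam)) = Fin gam.
  apply: le_anti; rewrite rep_ge andbT leNgt.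
  by rewrite -cls_eq0 ?rep_ge // repK.
exists (rep (xi gam)); apply: ds_ext => del /=; rewrite agam.
case: eqP => [[<-]|ne]; first by rewrite repK.
by apply: xi0; apply/eqP => dg; apply: ne; rewrite dg.
Qed.

End GradedComponents.

Arguments gr_comp {G F v V} alpha gam.
Arguments cls {G F v V} alpha gam x.
Arguments rep {G F v V alpha gam} e.
Arguments tilde {G F v V} alpha x.

Record filtered_pairing (G : orderedGroupType) (F : fieldType)
    (v : valuation G F) (U V W : lmodType F) (alpha : value_function v U)
    (beta : value_function v V) (rho : value_function v W) := FilteredPairing {
  pairing :> U -> V -> W;
  pairingDl : forall x y z, pairing (x + y) z = pairing x z + pairing y z;
  pairingDr : forall x y z, pairing z (x + y) = pairing z x + pairing z y;
  pairing_ge : forall x y, alpha x + beta y <= rho (pairing x y)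
}.

Section GradedSupport.
Variables (G : orderedGroupType) (F : fieldType) (v : valuation G F).
Variables (V : lmodType F) (alpha : value_function v V).

Definition gr_supp (f : gr alpha) : {fset G} := fset_set [set i | f i != 0].

Lemma notin_gr_supp f i : i \notin gr_supp f -> f i = 0.
Proof.
rewrite in_fset_set; last exact: ds_finite.
by rewrite notin_setE /= => /negP; rewrite negbK => /eqP.
Qed.

Lemma rep0_gt (f : gr alpha) i : f i = 0 -> Fin i < alpha (rep (f i)).
Proof. by move=> fi; rewrite -cls_eq0 ?rep_ge // repK fi. Qed.

Lemma cls_sum gam (I : Type) (s : seq I) (E : I -> V) :
  (forall i, Fin gam <= alpha (E i)) ->
  cls alpha gam (\sum_(i <- s) E i) = \sum_(i <- s) cls alpha gam (E i)
  /\ Fin gam <= alpha (\sum_(i <- s) E i).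
Proof.
move=> Ege; elim: s => [|i s [IH1 IH2]].
  by rewrite !big_nil cls0 vfun0 ext_lex1.
by rewrite !big_cons clsD // IH1 vfun_geD.
Qed.

Lemma cls_gt0 gam x : Fin gam < alpha x -> cls alpha gam x = 0.
Proof. by move=> gx; apply/eqP; rewrite cls_eq0 // ltW. Qed.

End GradedSupport.

Section GradedProduct.
Variables (G : orderedGroupType) (F : fieldType) (v : valuation G F).
Variables (U V W : lmodType F) (alpha : value_function v U).
Variables (beta : value_function v V) (rho : value_function v W).
Variable m : filtered_pairing alpha beta rho.
Implicit Types (f : gr alpha) (g : gr beta).

Lemma pairing0l y : m 0 y = 0.
Proof. by apply: (addIr (m 0 y)); rewrite -pairingDl !add0r. Qed.
Lemma pairing0r x : m x 0 = 0.
Proof. by apply: (addIr (m x 0)); rewrite -pairingDr !add0r. Qed.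
Lemma pairingNl x y : m (- x) y = - m x y.
Proof. by apply: (addIr (m x y)); rewrite -pairingDl !addNr pairing0l. Qed.
Lemma pairingNr x y : m x (- y) = - m x y.
Proof. by apply: (addIr (m x y)); rewrite -pairingDr !addNr pairing0r. Qed.

Lemma pairing_sumr x (I : Type) (s : seq I) (E : I -> V) :
  m x (\sum_(i <- s) E i) = \sum_(i <- s) m x (E i).
Proof.
by elim: s => [|i s IH]; rewrite ?big_nil ?pairing0r // !big_cons pairingDr IH.
Qed.

Lemma pairing_suml y (I : Type) (s : seq I) (E : I -> U) :
  m (\sum_(i <- s) E i) y = \sum_(i <- s) m (E i) y.
Proof.
by elim: s => [|i s IH]; rewrite ?big_nil ?pairing0l // !big_cons pairingDl IH.
Qed.

Lemma pairing_geD d e x y : Fin d <= alpha x -> Fin e <= beta y ->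
  Fin (d + e) <= rho (m x y).
Proof.
move=> dx ey; apply: (le_trans _ (pairing_ge m x y)).
by rewrite -ext_addE ext_leD.
Qed.

Lemma pairing_gtl d e x y : Fin d < alpha x -> Fin e <= beta y ->
  Fin (d + e) < rho (m x y).
Proof.
by move=> dx ey; apply: (lt_le_trans _ (pairing_ge m x y)); apply: ext_lt_le_add.
Qed.

Lemma pairing_gtr d e x y : Fin d <= alpha x -> Fin e < beta y ->
  Fin (d + e) < rho (m x y).
Proof.
by move=> dx ey; apply: (lt_le_trans _ (pairing_ge m x y)); apply: ext_le_lt_add.
Qed.

Lemma cls_pairing d e gam x x' y y' : gam = d + e ->
  Fin d <= alpha x -> Fin e <= beta y ->
  cls alpha d x = cls alpha d x' -> Fin d <= alpha x' ->
  cls beta e y = cls beta e y' -> Fin e <= beta y' ->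
  cls rho gam (m x y) = cls rho gam (m x' y').
Proof.
move=> -> dx ey /eqP xx' dx' /eqP yy' ey'; apply: cls_congr.
  exact: pairing_geD.
rewrite cls_eq // in xx'; rewrite cls_eq // in yy'.
have -> : m x y - m x' y' = m (x - x') y - m x' (y' - y).
  by rewrite pairingDl pairingDr pairingNl pairingNr opprD opprK addrA addrAC subrK.
apply: vfun_gtB; first exact: pairing_gtl.
by apply: pairing_gtr => //; rewrite -vfunN opprB.
Qed.

Definition gr_term f g (gam d : G) : gr_comp rho gam :=
  cls rho gam (m (rep (f d)) (rep (g (gam - d)))).

Lemma gr_term0l f g gam d : f d = 0 -> gr_term f g gam d = 0.
Proof.
move=> fd; apply: cls_gt0; rewrite -[X in Fin X](subrKC d).
by apply: pairing_gtl; [exact: rep0_gt | exact: rep_ge].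
Qed.

Lemma gr_term0r f g gam d : g (gam - d) = 0 -> gr_term f g gam d = 0.
Proof.
move=> gd; apply: cls_gt0; rewrite -[X in Fin X](subrKC d).
by apply: pairing_gtr; [exact: rep_ge | exact: rep0_gt].
Qed.

(* The component of degree [gam] of [f * g] is the sum over all
   decompositions [gam = d + (gam - d)]. *)
Definition gr_prod_fun f g (gam : G) : gr_comp rho gam :=
  \sum_(d \in [set: G]) gr_term f g gam d.

Lemma gr_prod_funE (A : {fset G}) f g gam :
  (forall d, d \notin A -> f d = 0 \/ g (gam - d) = 0) ->
  gr_prod_fun f g gam = \sum_(d <- A) gr_term f g gam d.
Proof.
move=> h; apply: fsbigTE => d /h[]; [exact: gr_term0l | exact: gr_term0r].
Qed.

Lemma gr_prod_suppE f g gam :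
  gr_prod_fun f g gam = \sum_(d <- gr_supp f) gr_term f g gam d.
Proof. by apply: gr_prod_funE => d /notin_gr_supp; left. Qed.

Lemma gr_prod_fun_supp f g gam :
  gam \notin [fset (d + e)%R | d in gr_supp f, e in gr_supp g]%fset ->
  gr_prod_fun f g gam = 0.
Proof.
move=> gN; rewrite gr_prod_suppE big_seq big1 // => d dA.
apply: gr_term0r; apply: notin_gr_supp; apply: contra gN => eB.
by apply/imfset2P; exists d => //; exists (gam - d); rewrite // subrKC.
Qed.

Lemma gr_prod_finite f g : finite_set [set gam | gr_prod_fun f g gam != 0].
Proof.
apply: (sub_finite_set _ (finite_fset
  [fset (d + e)%R | d in gr_supp f, e in gr_supp g]%fset)) => gam /= h.
by apply: contraNT h => /gr_prod_fun_supp ->.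
Qed.

Definition gr_prod f g : gr rho := DirectSum (gr_prod_finite f g).

Lemma rep_congrD f1 f2 d :
  cls alpha d (rep ((f1 + f2) d)) = cls alpha d (rep (f1 d) + rep (f2 d)).
Proof. by rewrite clsD ?rep_ge // !repK. Qed.

Lemma gr_prodDl f1 f2 g : gr_prod (f1 + f2) g = gr_prod f1 g + gr_prod f2 g.
Proof.
apply: ds_ext => gam; rewrite dsDE /=.
pose A := (gr_supp f1 `|` gr_supp f2)%fset.
have sA d : d \notin A -> f1 d = 0 /\ f2 d = 0.
  by rewrite inE negb_or => /andP[/notin_gr_supp -> /notin_gr_supp ->].
rewrite (@gr_prod_funE A f1) ?(@gr_prod_funE A f2); first last.
- by move=> d /sA[]; left.
- by move=> d /sA[]; left.
rewrite (@gr_prod_funE A); last first.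
  by move=> d /sA[f1d f2d]; left; rewrite dsDE f1d f2d addr0.
rewrite -big_split /=; apply: eq_bigr => d _; rewrite /gr_term.
have gE : gam = d + (gam - d) by rewrite subrKC.
rewrite -clsD -?pairingDl; try by rewrite {1}gE pairing_geD ?rep_ge.
apply: (cls_pairing gE); rewrite ?rep_ge ?vfun_geD ?rep_ge //.
by rewrite clsD ?rep_ge // !repK.
Qed.

Lemma gr_prodDr f g1 g2 : gr_prod f (g1 + g2) = gr_prod f g1 + gr_prod f g2.
Proof.
apply: ds_ext => gam; rewrite dsDE /= !gr_prod_suppE -big_split /=.
apply: eq_bigr => d _; rewrite /gr_term.
have gE : gam = d + (gam - d) by rewrite subrKC.
rewrite -clsD -?pairingDr; try by rewrite {1}gE pairing_geD ?rep_ge.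
apply: (cls_pairing gE); rewrite ?rep_ge ?vfun_geD ?rep_ge //.
by rewrite clsD ?rep_ge // !repK.
Qed.

Lemma gr_prod_tilde a b d e : alpha a = Fin d -> beta b = Fin e ->
  forall gam, gr_prod (tilde alpha a) (tilde beta b) gam =
    if gam == d + e then cls rho gam (m a b) else 0.
Proof.
move=> ad be gam /=; rewrite (@gr_prod_funE [fset d]%fset); last first.
  move=> d'; rewrite inE => d'd; left => /=; rewrite ad.
  by case: eqP => // -[dd']; rewrite dd' eqxx in d'd.
rewrite big_seq_fset1; case: (eqVneq gam (d + e)) => [gE|gN].
  have eE : gam - d = e by rewrite gE addrAC subrr add0r.
  rewrite /gr_term eE; apply: (cls_pairing gE); rewrite ?rep_ge ?ad ?be //.
    by rewrite repK /= ad eqxx.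
  by rewrite repK /= be eqxx.
apply: gr_term0r => /=; rewrite be; case: eqP => // -[eE].
by rewrite eE subrKC eqxx in gN.
Qed.

End GradedProduct.

Arguments cls_pairing {G F v U V W alpha beta rho} m {d e gam x x' y y'}.
Arguments gr_prod_funE {G F v U V W alpha beta rho} m A f g gam.

Section GradedProductUnit.
Variables (G : orderedGroupType) (F : fieldType) (v : valuation G F).
Variables (U V : lmodType F) (alpha : value_function v U).
Variable beta : value_function v V.

Lemma gr_prod1l (m : filtered_pairing alpha beta beta) u g :
  alpha u = 0 -> (forall y, m u y = y) -> gr_prod m (tilde alpha u) g = g.
Proof.
move=> u0 mu; apply: ds_ext => gam /=.
rewrite (gr_prod_funE _ [fset 0]%fset); last first.
  move=> d; rewrite inE => d0; left => /=; rewrite u0 ext_zeroE.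
  by case: eqP => // -[dd]; rewrite dd eqxx in d0.
rewrite big_seq_fset1 /gr_term subr0 -[RHS]repK -[in RHS](mu (rep (g gam))).
have gE : gam = 0 + gam by rewrite add0r.
apply: (cls_pairing _ gE); rewrite ?rep_ge ?u0 //.
by rewrite repK /= u0 ext_zeroE eqxx.
Qed.

Lemma gr_prod1r (m : filtered_pairing beta alpha beta) u g :
  alpha u = 0 -> (forall y, m y u = y) -> gr_prod m g (tilde alpha u) = g.
Proof.
move=> u0 mu; apply: ds_ext => gam /=.
rewrite (gr_prod_funE _ [fset gam]%fset); last first.
  move=> d; rewrite inE => d0; right => /=; rewrite u0 ext_zeroE.
  case: eqP => // -[dd]; case/eqP: d0; apply/esym/eqP.
  by rewrite -subr_eq0 -dd.
rewrite big_seq_fset1 /gr_term subrr -[RHS]repK -[in RHS](mu (rep (g gam))).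
have gE : gam = gam + 0 by rewrite addr0.
apply: (cls_pairing _ gE); rewrite ?rep_ge ?u0 //.
by rewrite repK /= u0 ext_zeroE eqxx.
Qed.

End GradedProductUnit.

Section GradedProductComm.
Variables (G : orderedGroupType) (F : fieldType) (v : valuation G F).
Variables (U V W : lmodType F) (alpha : value_function v U).
Variables (beta : value_function v V) (rho : value_function v W).

Lemma gr_prodC (m : filtered_pairing alpha beta rho)
    (m' : filtered_pairing beta alpha rho) f g :
  (forall x y, m x y = m' y x) -> gr_prod m f g = gr_prod m' g f.
Proof.
move=> mC; apply: ds_ext => gam /=; rewrite /gr_prod_fun.
rewrite (@reindex_fsbigT _ _ _ _ _ (fun d => gam - d)); last first.
  by exists (fun d => gam - d) => d; rewrite subKr.
apply: eq_fsbigr => d _; rewrite /gr_term subKr mC.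
by [].
Qed.

End GradedProductComm.

Section GradedProductAssoc.
Variables (G : orderedGroupType) (F : fieldType) (v : valuation G F).
Variables (V1 V2 V3 V12 V23 V : lmodType F).
Variables (a1 : value_function v V1) (a2 : value_function v V2).
Variables (a3 : value_function v V3) (a12 : value_function v V12).
Variables (a23 : value_function v V23) (a : value_function v V).
Variables (m12 : filtered_pairing a1 a2 a12) (m12_3 : filtered_pairing a12 a3 a).
Variables (m23 : filtered_pairing a2 a3 a23) (m1_23 : filtered_pairing a1 a23 a).
Hypothesis mA : forall x y z, m1_23 x (m23 y z) = m12_3 (m12 x y) z.

Lemma gr_prodA f g h :
  gr_prod m1_23 f (gr_prod m23 g h) = gr_prod m12_3 (gr_prod m12 f g) h.
Proof.
apply: ds_ext => gam /=.
pose S := [fset (d + e)%R | d in gr_supp f, e in gr_supp g]%fset.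
pose T d e eta := cls a gam
  (m12_3 (m12 (rep (f d)) (rep (g e))) (rep (h (gam - eta)))).
have -> : gr_prod_fun m12_3 (gr_prod m12 f g) h gam =
    \sum_(eta <- S) \sum_(d <- gr_supp f) T d (eta - d) eta.
  rewrite (gr_prod_funE _ S); last first.
    by move=> eta /gr_prod_fun_supp h0; left; apply: h0.
  apply: eq_bigr => eta _; rewrite /gr_term /=.
  have gE : gam = eta + (gam - eta) by rewrite subrKC.
  have ge d : Fin eta <= a12 (m12 (rep (f d)) (rep (g (eta - d)))).
    by rewrite -[X in Fin X](subrKC d) pairing_geD ?rep_ge.
  have [s1 s2] := cls_sum (gr_supp f) ge.
  rewrite (cls_pairing _ (x' := \sum_(d <- gr_supp f)
     m12 (rep (f d)) (rep (g (eta - d)))) (y' := rep (h (gam - eta))) gE);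
    rewrite ?rep_ge //; last by rewrite repK gr_prod_suppE s1.
  rewrite pairing_suml.
  apply: (proj1 (cls_sum _ _)) => d.
  by rewrite {1}gE pairing_geD ?rep_ge.
rewrite exchange_big /= gr_prod_suppE big_seq [RHS]big_seq.
apply: eq_bigr => d df.
have -> : \sum_(eta <- S) T d (eta - d) eta
    = \sum_(eta \in [set: G]) T d (eta - d) eta.
  apply/esym/fsbigTE => eta etaN; apply: cls_gt0.
  have gE : gam = (d + (eta - d)) + (gam - eta) by rewrite !subrKC.
  rewrite [X in Fin X]gE.
  apply: pairing_gtl; last exact: rep_ge.
  apply: pairing_gtr; first exact: rep_ge.
  apply: rep0_gt; apply: notin_gr_supp; apply: contra etaN => eg.
  by apply/imfset2P; exists d => //; exists (eta - d); rewrite // subrKC.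
rewrite (@reindex_fsbigT _ _ _ _ _ (fun e => d + e)); last first.
  by exists (fun e => e - d) => e; rewrite ?subrKC // addrAC subrr add0r.
have addK e : d + e - d = e by rewrite addrAC subrr add0r.
under eq_fsbigr do rewrite addK.
rewrite (@fsbigTE _ _ _ _ (gr_supp g)); last first.
  move=> e /notin_gr_supp ge; apply: cls_gt0.
  have gE : gam = (d + e) + (gam - (d + e)) by rewrite subrKC.
  rewrite [X in Fin X]gE.
  apply: pairing_gtl; last exact: rep_ge.
  by apply: pairing_gtr; [exact: rep_ge | exact: rep0_gt].
rewrite /gr_term.
have gE : gam = d + (gam - d) by rewrite subrKC.
have ge e : Fin (gam - d) <= a23 (m23 (rep (g e)) (rep (h (gam - d - e)))).
  by rewrite -[X in Fin X](subrKC e) pairing_geD ?rep_ge.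
have [s1 s2] := cls_sum (gr_supp g) ge.
rewrite (cls_pairing _ (x' := rep (f d)) (y' := \sum_(e <- gr_supp g)
     m23 (rep (g e)) (rep (h (gam - d - e)))) gE);
  rewrite ?rep_ge //; last by rewrite repK /= gr_prod_suppE s1.
rewrite pairing_sumr.
have ge' e : Fin gam <=
    a (m1_23 (rep (f d)) (m23 (rep (g e)) (rep (h (gam - d - e))))).
  by rewrite {1}gE pairing_geD ?rep_ge.
rewrite (proj1 (cls_sum (gr_supp g) ge')).
by apply: eq_bigr => e _; rewrite /T mA opprD addrA.
Qed.

End GradedProductAssoc.

Section GradedRing.
Variables (G : orderedGroupType) (F : fieldType) (v : valuation G F).
Variables (A : algType F) (phi : surmultiplicative v A).

Definition mul_pairing : filtered_pairing phi phi phi :=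
  FilteredPairing (fun x y z => mulrDl x y z) (fun x y z => mulrDr z x y)
    (surmM phi).

Definition gr_alg := gr phi.

HB.instance Definition _ := GRing.Zmodule.on gr_alg.

Definition gr_mul : gr_alg -> gr_alg -> gr_alg := gr_prod mul_pairing.
Definition gr_one : gr_alg := tilde phi 1.

Lemma gr_mulA : associative gr_mul.
Proof. by apply: gr_prodA => x y z /=; rewrite mulrA. Qed.
Lemma gr_mul1l : left_id gr_one gr_mul.
Proof. by move=> f; apply: gr_prod1l (surm1 phi) _ => y /=; rewrite mul1r. Qed.
Lemma gr_mul1r : right_id gr_one gr_mul.
Proof. by move=> f; apply: gr_prod1r (surm1 phi) _ => y /=; rewrite mulr1. Qed.
Lemma gr_mulDl : left_distributive gr_mul +%R.
Proof. by move=> f g h; apply: gr_prodDl. Qed.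
Lemma gr_mulDr : right_distributive gr_mul +%R.
Proof. by move=> f g h; apply: gr_prodDr. Qed.
Lemma gr_one_neq0 : gr_one != 0.
Proof.
apply/eqP => /(congr1 (fun f : gr_alg => f 0)) /eqP /=.
by rewrite surm1 ext_zeroE eqxx cls_eq0 surm1 // ltxx.
Qed.

HB.instance Definition _ := GRing.Zmodule_isNzRing.Build gr_alg
  gr_mulA gr_mul1l gr_mul1r gr_mulDl gr_mulDr gr_one_neq0.

Lemma gr_mul_tilde (a b : A) (d e : G) : phi a = Fin d -> phi b = Fin e ->
  forall gam, ((tilde phi a : gr_alg) * (tilde phi b : gr_alg)) gam =
    if gam == d + e then cls phi gam (a * b) else 0.
Proof. exact: gr_prod_tilde. Qed.

End GradedRing.

Section GradedField.
Variables (G : orderedGroupType) (F : fieldType) (v : valuation G F).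

Lemma valuation_scale (c : F) (x : F^o) : v (c *: x) = v x + v c.
Proof. by rewrite valuation_mul addrC. Qed.

Definition valuation_vfun : value_function v F^o :=
  @ValueFunction G F v F^o v (valuation_inf v) (valuation_add v) valuation_scale.

Lemma valuation_surmM (x y : F^o) :
  valuation_vfun x + valuation_vfun y <= valuation_vfun (x * y).
Proof. by rewrite /= valuation_mul. Qed.

Definition valuation_surm : surmultiplicative v F^o :=
  @Surmultiplicative G F v F^o valuation_vfun (valuation1 v) valuation_surmM.

(* [gr F] is the graded ring of [F], as an algebra over itself valued by [v]. *)
Definition gr_field := gr_alg valuation_surm.

HB.instance Definition _ := GRing.NzRing.on gr_field.

Lemma gr_field_mulC (f g : gr_field) : f * g = g * f.
Proof. by apply: gr_prodC => x y /=; rewrite mulrC. Qed.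

HB.instance Definition _ :=
  GRing.PzRing_hasCommutativeMul.Build gr_field gr_field_mulC.

End GradedField.

Section GradedModule.
Variables (G : orderedGroupType) (F : fieldType) (v : valuation G F).
Variables (V : lmodType F) (alpha : value_function v V).

Lemma scale_pairing_ge (c : F^o) (x : V) :
  valuation_surm v c + alpha x <= alpha ((c : F) *: x).
Proof. by rewrite vfun_scale addrC. Qed.

Definition scale_pairing : filtered_pairing (valuation_surm v) alpha alpha :=
  @FilteredPairing G F v F^o V V (valuation_surm v) alpha alpha
    (fun (c : F^o) (x : V) => (c : F) *: x)
    (fun c d x => scalerDl x c d) (fun x y c => scalerDr c x y)
    scale_pairing_ge.

Definition gr_scale : gr_field v -> gr alpha -> gr alpha :=
  gr_prod scale_pairing.

Lemma gr_scaleA a b x : gr_scale a (gr_scale b x) = gr_scale (a * b) x.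
Proof. by apply: gr_prodA => c d y /=; rewrite scalerA. Qed.
Lemma gr_scale1 : left_id 1 gr_scale.
Proof.
move=> x.
by apply: (@gr_prod1l G F v F^o V (valuation_surm v) alpha scale_pairing 1 x
  (valuation1 v)) => y /=; rewrite scale1r.
Qed.
Lemma gr_scaleDr : right_distributive gr_scale +%R.
Proof. by move=> a x y; apply: gr_prodDr. Qed.
Lemma gr_scaleDl x : {morph gr_scale^~ x : a b / a + b}.
Proof. by move=> a b; apply: gr_prodDl. Qed.

HB.instance Definition _ := GRing.Zmodule_isLmodule.Build (gr_field v) (gr alpha)
  gr_scaleA gr_scale1 gr_scaleDr gr_scaleDl.

End GradedModule.

Section GradedAlgebra.
Variables (G : orderedGroupType) (F : fieldType) (v : valuation G F).
Variables (A : algType F) (phi : surmultiplicative v A).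
Implicit Types (a : gr_field v) (x y : gr_alg phi).

HB.instance Definition _ := GRing.Lmodule.on (gr_alg phi).

Lemma gr_scaleAl a x y : a *: (x * y) = (a *: x) * y.
Proof. by apply: gr_prodA => c b d /=; rewrite scalerAl. Qed.

HB.instance Definition _ := GRing.Lmodule_isLalgebra.Build
  (gr_field v) (gr_alg phi) gr_scaleAl.

Lemma gr_scaleAr a x y : a *: (x * y) = x * (a *: y).
Proof.
pose r : filtered_pairing phi (valuation_surm v) phi :=
  @FilteredPairing G F v A F^o A phi (valuation_surm v) phi
    (fun (z : A) (c : F^o) => (c : F) *: z)
    (fun z t c => scalerDr c z t) (fun c d z => scalerDl z c d)
    (fun z c => eq_ind_r (fun t => _ <= t) (lexx _) (vfun_scale phi (c : F) z)).
rewrite gr_scaleAl; have -> : a *: x = gr_prod r x a by apply: gr_prodC.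
by apply/esym; apply: gr_prodA => z c t /=; rewrite -scalerAr scalerAl.
Qed.

HB.instance Definition _ := GRing.Lalgebra_isAlgebra.Build
  (gr_field v) (gr_alg phi) gr_scaleAr.

Lemma gr_scale_tilde (c : F) (z : A) (d e : G) :
  v c = Fin d -> phi z = Fin e ->
  forall gam, (((tilde (valuation_surm v) (c : F^o) : gr_field v)
      *: (tilde phi z : gr_alg phi)) : gr_alg phi) gam =
    if gam == d + e then cls phi gam (c *: z) else 0.
Proof.
move=> cd ze.
exact: (@gr_prod_tilde G F v F^o A A (valuation_surm v) phi phi
  (scale_pairing phi) c z d e cd ze).
Qed.

End GradedAlgebra.

Definition invariant_under (G : orderedGroupType) (F : fieldType)
    (v : valuation G F) (A : algType F) (phi : surmultiplicative v A)
    (sigma : involution A) : Prop :=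
  forall x, phi (sigma x) = phi x.

Section GradedInvolution.
Variables (G : orderedGroupType) (F : fieldType) (v : valuation G F).
Variables (A : algType F) (phi : surmultiplicative v A).
Variables (sigma : involution A) (sigma_phi : invariant_under phi sigma).

Lemma involD x y : sigma (x + y) = sigma x + sigma y.
Proof. by rewrite -[x]scale1r invol_linear !scale1r. Qed.
Lemma invol0 : sigma 0 = 0.
Proof. by apply: (addIr (sigma 0)); rewrite -involD !add0r. Qed.
Lemma involN x : sigma (- x) = - sigma x.
Proof. by apply: (addIr (sigma x)); rewrite -involD !addNr invol0. Qed.
Lemma involZ (c : F) x : sigma (c *: x) = c *: sigma x.
Proof. by rewrite -[c *: x]addr0 invol_linear invol0 addr0. Qed.

Lemma cls_invol gam x y : Fin gam <= phi x -> Fin gam <= phi y ->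
  cls phi gam x = cls phi gam y ->
  cls phi gam (sigma x) = cls phi gam (sigma y).
Proof.
move=> gx gy /eqP; rewrite cls_eq // => gxy.
by apply: cls_congr; rewrite -?involN -?involD sigma_phi.
Qed.

Lemma gr_invol_finite (f : gr_alg phi) :
  finite_set [set gam | cls phi gam (sigma (rep (f gam))) != 0].
Proof.
apply: (sub_finite_set _ (ds_finite f)) => gam /=; apply: contraNN => /eqP fg.
by apply/eqP/cls_gt0; rewrite sigma_phi rep0_gt.
Qed.

Definition gr_invol_fun (f : gr_alg phi) : gr_alg phi :=
  DirectSum (gr_invol_finite f).

Lemma gr_invol_funD f g :
  gr_invol_fun (f + g) = gr_invol_fun f + gr_invol_fun g.
Proof.
apply: ds_ext => gam; rewrite dsDE /= -clsD ?sigma_phi ?rep_ge // -involD.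
by apply: cls_invol; rewrite ?vfun_geD ?rep_ge // clsD ?rep_ge // !repK.
Qed.

Lemma invol_sum (I : Type) (s : seq I) (E : I -> A) :
  sigma (\sum_(i <- s) E i) = \sum_(i <- s) sigma (E i).
Proof.
by elim: s => [|i s IH]; rewrite ?big_nil ?invol0 // !big_cons involD IH.
Qed.

Lemma gr_invol_prod (U U' V V' : lmodType F)
    (alpha : value_function v U) (alpha' : value_function v U')
    (beta : value_function v V) (beta' : value_function v V')
    (m : filtered_pairing alpha beta phi)
    (m' : filtered_pairing alpha' beta' phi) (s : U -> U') (t : V -> V')
    (h : gr alpha) (h' : gr alpha') (g : gr beta) (g' : gr beta') :
  (forall x, alpha' (s x) = alpha x) -> (forall y, beta' (t y) = beta y) ->
  (forall x y, sigma (m x y) = m' (s x) (t y)) ->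
  (forall d, h' d = cls alpha' d (s (rep (h d)))) ->
  (forall d, g' d = cls beta' d (t (rep (g d)))) ->
  gr_invol_fun (gr_prod m h g) = gr_prod m' h' g'.
Proof.
move=> sa tb sm hE gE; apply: ds_ext => gam.
have dE d : gam = d + (gam - d) by rewrite subrKC.
have ge d : Fin gam <= phi (m (rep (h d)) (rep (g (gam - d)))).
  by rewrite {1}(dE d) pairing_geD ?rep_ge.
have [s1 s2] := cls_sum (gr_supp h) ge.
rewrite /= (@cls_invol gam _
  (\sum_(d <- gr_supp h) m (rep (h d)) (rep (g (gam - d)))));
  rewrite ?rep_ge //; last by rewrite repK /= gr_prod_suppE s1.
rewrite invol_sum (proj1 (cls_sum _ _)); last by move=> d; rewrite sigma_phi.
rewrite (gr_prod_funE m' (gr_supp h)); last first.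
  move=> d /notin_gr_supp hd; left; rewrite hE; apply: cls_gt0.
  by rewrite sa rep0_gt.
apply: eq_bigr => d _; rewrite /gr_term sm.
by apply: (cls_pairing _ (dE d)); rewrite ?sa ?tb ?rep_ge // repK.
Qed.

Lemma gr_involZ (a : gr_field v) (f : gr_alg phi) :
  gr_invol_fun (a *: f) = a *: gr_invol_fun f.
Proof.
apply: (@gr_invol_prod F^o F^o A A (valuation_surm v) (valuation_surm v)
  phi phi (scale_pairing phi) (scale_pairing phi) id sigma) => //.
- by move=> c x /=; rewrite involZ.
- by move=> d; rewrite repK.
Qed.

Lemma gr_invol_linear (a : gr_field v) (f g : gr_alg phi) :
  gr_invol_fun (a *: f + g) = a *: gr_invol_fun f + gr_invol_fun g.
Proof. by rewrite gr_invol_funD gr_involZ. Qed.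

Lemma gr_involM (f g : gr_alg phi) :
  gr_invol_fun (f * g) = gr_invol_fun g * gr_invol_fun f.
Proof.
have mop_ge (x y : A) : phi x + phi y <= phi (y * x).
  by rewrite addrC surmM.
pose mop : filtered_pairing phi phi phi :=
  @FilteredPairing G F v A A A phi phi phi (fun x y => y * x)
    (fun x y z => mulrDr z x y) (fun x y z => mulrDl x y z) mop_ge.
transitivity (gr_prod mop (gr_invol_fun f) (gr_invol_fun g)).
  apply: (@gr_invol_prod A A A A phi phi phi phi (mul_pairing phi) mop
    sigma sigma) => // x y.
  by rewrite /= involM.
by apply: gr_prodC.
Qed.

Lemma gr_involK : involutive gr_invol_fun.
Proof.
move=> f; apply: ds_ext => gam /=.
transitivity (cls phi gam (sigma (sigma (rep (f gam))))); last first.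
  by rewrite involK repK.
by apply: cls_invol; rewrite ?sigma_phi ?rep_ge // repK.
Qed.

Definition gr_involution : involution (gr_alg phi) :=
  Involution gr_invol_linear gr_involM gr_involK.

Lemma gr_involution_tilde x :
  gr_involution (tilde phi x) = tilde phi (sigma x).
Proof.
apply: ds_ext => gam /=; rewrite sigma_phi; case: eqP => [xg|_].
  by apply: cls_invol; rewrite ?rep_ge ?xg // repK.
transitivity (cls phi gam (sigma 0)); last by rewrite invol0 cls0.
by apply: cls_invol; rewrite ?rep_ge ?vfun0 ?ext_lex1 // repK cls0.
Qed.

End GradedInvolution.

Definition gr_anisotropic (G : orderedGroupType) (F : fieldType)
    (v : valuation G F) (A : algType F) (phi : surmultiplicative v A)
    (tau : involution (gr_alg phi)) : Prop :=
  ~ exists xi : gr_alg phi, [/\ xi <> 0, homogeneous xi & tau xi * xi = 0].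

(* In a unital algebra, left or right ideals of the underlying ring are
   automatically stable under scalars. *)
Definition left_ideal (R : nzRingType) (I : set R) : Prop :=
  [/\ I 0, forall x y, I x -> I y -> I (x + y) & forall a x, I x -> I (a * x)].

Definition right_ideal (R : nzRingType) (I : set R) : Prop :=
  [/\ I 0, forall x y, I x -> I y -> I (x + y) & forall a x, I x -> I (x * a)].

Definition nil_subset (R : nzRingType) (I : set R) : Prop :=
  forall x, I x -> exists n : nat, x ^+ n = 0.

(* [I] is the ideal (of the kind given by [ideal]) generated by a set of
   homogeneous elements. *)
Definition generated_by_homogeneous (G : orderedGroupType) (F : fieldType)
    (v : valuation G F) (A : algType F) (phi : surmultiplicative v A)
    (ideal : set (gr_alg phi) -> Prop) (I : set (gr_alg phi)) : Prop :=
  exists S : set (gr_alg phi),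
    (forall xi, S xi -> homogeneous xi) /\ I = smallest ideal S.

(* Main.v *)
Require Import Defs.
From mathcomp Require Import all_boot all_order all_algebra.
From mathcomp Require Import boolp classical_sets.

(** The product of two initial forms [tilde x * tilde y] is the class of [x * y]
in degree [phi x + phi y].  It therefore vanishes exactly when the inequality
[phi x + phi y <= phi (x * y)] is strict, and equals [tilde (x * y)] otherwise
([tildeM_eq0], [tildeM]).

Call (a) the identity [phi (sigma x * x) = 2 phi x].  With
[phi (sigma x) + phi x <= phi (sigma x * x)] it gives [phi (sigma x) <= phi x],
and, applied to [sigma x], the reverse inequality; so [phi] is invariant.  Once
[phi] is invariant, (a) for a nonzero [x] says that the inequality
[phi (sigma x) + phi x <= phi (sigma x * x)] is an equality, that is, that
[tilde (sigma x) * tilde x] is nonzero.  Since every homogeneous element is an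
initial form, this is anisotropy of the induced involution.

If [sigma x * y = 0], then [sigma x * x = sigma x * (x + y)], so
[2 phi x >= phi x + phi (x + y)] and [phi x >= phi (x + y)].  As
[sigma y * x = 0] too, the same holds for [y].

A one-sided ideal generated by homogeneous elements, if nonzero, contains some
[tilde x] with [x] nonzero, hence also [tilde (sigma x * x)] (left case) or
[tilde (x * sigma x)] (right case).  That is the initial form of a nonzero
symmetric element [h], and for symmetric elements (a) reads
[phi (h ^ 2) = 2 phi h]; so the powers of [tilde h] of exponent [2 ^ k] are the
initial forms of those of [h] and never vanish ([tilde_symmetric_expn_neq0]). *)

Set Implicit Arguments.
Unset Strict Implicit.
Unset Printing Implicit Defensive.

Import Order.TTheory GRing.Theory.

Local Open Scope classical_set_scope.
Local Open Scope ring_scope.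

Lemma ext_mul2_Inf (G : orderedGroupType) (g : ext G) : g *+ 2 = Inf -> g = Inf.
Proof. by case: g. Qed.

Lemma ext_le_double (G : orderedGroupType) (g h : ext G) :
  g <> Inf -> h + g <= g *+ 2 -> h <= g.
Proof.
case: g => // a _; case: h => // b.
by rewrite mulr2n !ext_addE !ext_leE og_lerD2rE.
Qed.

Section InitialForms.
Variables (G : orderedGroupType) (F : fieldType) (v : valuation G F).
Variables (A : algType F) (phi : surmultiplicative v A).
Implicit Types x y : A.

Local Notation tl x := (tilde phi x : gr_alg phi).

Lemma vfun_fin x : x <> 0 -> exists d, phi x = Fin d.
Proof. by move=> x0; case E: (phi x) => [d|]; [exists d | move/vfun_inf: E]. Qed.

Lemma tilde_eq0 x : tl x = 0 -> x = 0.
Proof.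
move=> tx; apply: contrapT => /vfun_fin[d xd].
move/(congr1 (fun f : gr_alg phi => f d))/eqP: tx => /=.
by rewrite xd eqxx cls_eq0 xd // ltxx.
Qed.

Lemma tildeM_eq0 x y : x <> 0 -> y <> 0 ->
  tl x * tl y = 0 <-> phi x + phi y < phi (x * y).
Proof.
move=> /vfun_fin[d xd] /vfun_fin[e ye].
have ge : Fin (d + e) <= phi (x * y) by rewrite -ext_addE -xd -ye surmM.
rewrite xd ye ext_addE -cls_eq0 //; split=> [|/eqP cl0].
  move/(congr1 (fun f : gr_alg phi => f (d + e))).
  by rewrite (gr_mul_tilde xd ye) eqxx => ->.
apply: ds_ext => gam; rewrite (gr_mul_tilde xd ye).
by case: eqP => // ->.
Qed.

Lemma tildeM x y : phi (x * y) = phi x + phi y -> tl x * tl y = tl (x * y).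
Proof.
have [->|/eqP x0] := eqVneq x 0; first by rewrite mul0r tilde0 mul0r.
have [->|/eqP y0] := eqVneq y 0; first by rewrite mulr0 tilde0 mulr0.
move: x0 y0 => /vfun_fin[d xd] /vfun_fin[e ye].
rewrite xd ye ext_addE => xyde.
apply: ds_ext => gam; rewrite (gr_mul_tilde xd ye) /= xyde.
case: eqP => [->|gde]; first by rewrite eqxx.
by case: eqP => // -[deg]; case: gde.
Qed.

End InitialForms.

Section MultiplicativeNorm.
Variables (G : orderedGroupType) (F : fieldType) (v : valuation G F).
Variables (A : algType F) (sigma : involution A) (phi : surmultiplicative v A).
Implicit Types x y h : A.

Local Notation tl x := (tilde phi x : gr_alg phi).

Lemma invol_eq0 x : sigma x = 0 -> x = 0.
Proof. by move=> sx; rewrite -[x](involK sigma) sx invol0. Qed.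

(** Both conditions test the same inequality
[phi (sigma x) + phi x <= phi (sigma x * x)] for equality. *)
Lemma gr_anisotropicE (sigma_phi : invariant_under phi sigma) :
  gr_anisotropic (gr_involution sigma_phi) <->
  (forall x, phi (sigma x * x) = phi x *+ 2).
Proof.
split=> [an x | sq [xi [xi0 /homogeneousE[x xix]]]].
  have [->|/eqP x0] := eqVneq x 0; first by rewrite mulr0 vfun0.
  apply: le_anti; rewrite mulr2n -{3}(sigma_phi x) surmM andbT leNgt.
  apply/negP => lt; apply: an; exists (tl x).
  split; [by move/tilde_eq0 | exact: tilde_homogeneous |].
  rewrite gr_involution_tilde; apply/tildeM_eq0 => //; first by move/invol_eq0.
  by rewrite sigma_phi.
have x0 : x <> 0 by move=> x0; apply: xi0; rewrite xix x0 tilde0.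
rewrite xix gr_involution_tilde tildeM_eq0 //; last by move/invol_eq0.
by rewrite sq sigma_phi mulr2n ltxx.
Qed.

Hypothesis phi_norm : forall x, phi (sigma x * x) = phi x *+ 2.

Lemma norm_anisotropic : anisotropic sigma.
Proof.
move=> [x [x0 sxx]]; apply/x0/(vfun_inf phi)/ext_mul2_Inf.
by rewrite -phi_norm sxx vfun0.
Qed.

Lemma norm_invariant : invariant_under phi sigma.
Proof.
have le x : phi (sigma x) <= phi x.
  have [->|/eqP x0] := eqVneq x 0; first by rewrite invol0.
  apply: ext_le_double; first by move/vfun_inf.
  by rewrite -phi_norm surmM.
by move=> x; apply: le_anti; rewrite le -{1}[x](involK sigma) le.
Qed.

Lemma vfunD_orthogonal x y : sigma x * y = 0 ->
  phi (x + y) = Num.min (phi x) (phi y).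
Proof.
have le a b : sigma a * b = 0 -> phi (a + b) <= phi a.
  have [->|/eqP a0] := eqVneq a 0; first by rewrite vfun0 ext_lex1.
  move=> sab; apply: ext_le_double; first by move/vfun_inf.
  have -> : phi a *+ 2 = phi (sigma a * (a + b)).
    by rewrite mulrDr sab addr0 phi_norm.
  by rewrite addrC -{1}(norm_invariant a) surmM.
move=> sxy; apply: le_anti; rewrite vfun_add le_min le //= andbT addrC le //.
by apply: invol_eq0; rewrite involM involK.
Qed.

Lemma vfunD_orthogonal_right x y : x * sigma y = 0 ->
  phi (x + y) = Num.min (phi x) (phi y).
Proof.
move=> xsy; rewrite -norm_invariant involD vfunD_orthogonal ?norm_invariant //.
by rewrite involK.
Qed.

Lemma tilde_norm_left x : tl (sigma x) * tl x = tl (sigma x * x).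
Proof. by apply: tildeM; rewrite phi_norm norm_invariant mulr2n. Qed.

Lemma tilde_norm_right x : tl x * tl (sigma x) = tl (x * sigma x).
Proof. by rewrite -{1 3}[x](involK sigma) tilde_norm_left. Qed.

(** Squaring keeps [h] symmetric and nonzero, and commutes with taking initial
forms; a nilpotent element would have a vanishing power of exponent [2 ^ k]. *)
Lemma tilde_symmetric_expn_neq0 h n : sigma h = h -> h <> 0 -> tl h ^+ n <> 0.
Proof.
move=> sh h0 hn.
have sq k : tl h ^+ (2 ^ k) = tl (h ^+ (2 ^ k)) /\
    sigma (h ^+ (2 ^ k)) = h ^+ (2 ^ k) /\ h ^+ (2 ^ k) <> 0.
  elim: k => [|k [tE [sE N0]]]; first by rewrite expn0 !expr1.
  rewrite expnSr !exprM tE; move: (h ^+ (2 ^ k)) sE N0 => b sE N0.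
  split; first by rewrite !expr2 -{1}sE tilde_norm_left sE.
  rewrite expr2 involM sE; split=> // bb; apply: norm_anisotropic.
  by exists b; rewrite sE.
have [tE [_ N0]] := sq n; apply/N0/(@tilde_eq0 _ _ _ _ phi).
by rewrite -tE -(subnK (ltnW (ltn_expl n (ltnSn 1)))) exprD hn mulr0.
Qed.

(** Left and right ideals are treated together: [ideal] is the kind of ideal,
and [h] stands for [sigma x * x] or [x * sigma x]. *)
Lemma nil_homogeneous_ideal_eq0 (ideal : set (gr_alg phi) -> Prop)
    (I : set (gr_alg phi)) :
  ideal [set 0] -> I 0 -> generated_by_homogeneous ideal I -> nil_subset I ->
  (forall x, x <> 0 -> I (tl x) ->
     exists h, [/\ sigma h = h, h <> 0 & I (tl h)]) ->
  I = [set 0].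
Proof.
move=> id0 I0 [S [homS IE]] nilI symI; apply/seteqP; split; last by move=> _ ->.
rewrite IE; apply: smallest_sub => // xi Sxi.
have Ixi : I xi by rewrite IE; apply: sub_gen_smallest.
have /homogeneousE[x xix] := homS _ Sxi.
have [x0|/eqP x0] := eqVneq x 0; first by rewrite /= xix x0 tilde0.
rewrite xix in Ixi; have [h [sh h0 /nilI[n hn]]] := symI _ x0 Ixi.
by case: (tilde_symmetric_expn_neq0 sh h0 hn).
Qed.

Lemma nil_homogeneous_left_ideal_eq0 (I : set (gr_alg phi)) :
  left_ideal I -> generated_by_homogeneous (@left_ideal _) I -> nil_subset I ->
  I = [set 0].
Proof.
move=> [I0 _ IM] gI nilI; apply: nil_homogeneous_ideal_eq0 gI nilI _ => //.
  by split=> //= [x y -> ->|a x ->]; rewrite ?addr0 ?mulr0.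
move=> x x0 Ix; exists (sigma x * x); split.
- by rewrite involM involK.
- by move=> sxx; apply: norm_anisotropic; exists x.
- by rewrite -tilde_norm_left; apply: IM.
Qed.

Lemma nil_homogeneous_right_ideal_eq0 (I : set (gr_alg phi)) :
  right_ideal I -> generated_by_homogeneous (@right_ideal _) I ->
  nil_subset I -> I = [set 0].
Proof.
move=> [I0 _ IM] gI nilI; apply: nil_homogeneous_ideal_eq0 gI nilI _ => //.
  by split=> //= [x y -> ->|a x ->]; rewrite ?addr0 ?mul0r.
move=> x x0 Ix; exists (x * sigma x); split.
- by rewrite involM involK.
- move=> xsx; apply: norm_anisotropic; exists (sigma x); rewrite involK.
  by split=> // /invol_eq0.
- by rewrite -tilde_norm_right; apply: IM.
Qed.

End MultiplicativeNorm.

Theorem proposition1p1 (G : orderedGroupType) (G_div : divisible_group G)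
    (F : fieldType) (v : valuation G F) (A : algType F)
    (sigma : involution A) (phi : surmultiplicative v A) :
  ((forall x : A, phi (sigma x * x) = phi x *+ 2) <->
   (exists sigma_phi : invariant_under phi sigma,
      gr_anisotropic (gr_involution sigma_phi))) /\
  ((forall x : A, phi (sigma x * x) = phi x *+ 2) ->
   [/\ forall x y : A, sigma x * y = 0 \/ x * sigma y = 0 ->
         phi (x + y) = Num.min (phi x) (phi y),
       anisotropic sigma,
       ~ (exists I : set (gr_alg phi),
           [/\ left_ideal I, generated_by_homogeneous (@left_ideal _) I,
               nil_subset I & I <> [set 0]]) &
       ~ (exists I : set (gr_alg phi),
           [/\ right_ideal I, generated_by_homogeneous (@right_ideal _) I,
               nil_subset I & I <> [set 0]])]).
Proof.
split; first split=> [phi_norm | [sigma_phi /gr_anisotropicE //]].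
  by exists (norm_invariant phi_norm); apply/gr_anisotropicE.
move=> phi_norm; split.
- move=> x y [] xy; first exact: (vfunD_orthogonal phi_norm).
  exact: (vfunD_orthogonal_right phi_norm).
- exact: norm_anisotropic phi_norm.
- by move=> [I [lI gI nI]]; apply; apply: nil_homogeneous_left_ideal_eq0 nI.
- by move=> [I [rI gI nI]]; apply; apply: nil_homogeneous_right_ideal_eq0 nI.
Qed.
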